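(* Let $k \ge 3$ and let $n$ be a positive integer with $n \equiv 2 \pmod{k-1}$. Suppose that the edges of the complete $k$-uniform hypergraph $K_n^k$ are colored with two colors, red and blue. Then the vertex set $V(K_n^k)$ can be partitioned into a red loose path and a blue loose path (i.e., two vertex-disjoint monochromatic loose paths of distinct colors whose vertex sets together cover all vertices).
   Context: $K_n^k$ is the complete $k$-uniform hypergraph on $n$ vertices: its edges are all $k$-element subsets of an $n$-element vertex set. A $k$-uniform loose path of length $\ell \ge 1$ is a $k$-uniform hypergraph with edges $e_1,\dots,e_\ell$ such that $|e_i \cap e_{i+1}| = 1$ for all $i \in [\ell-1]$ and $|e_i \cap e_j| = 0$ for all other pairs $i \ne j$; it is red (resp. blue) if all its edges are red (resp. blue). By convention, a set of fewer than $k$ vertices (including the empty set) is accepted as a loose path of either color. *)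

(* Defs.v *)
From mathcomp Require Import all_boot.

Set Implicit Arguments.
Unset Strict Implicit.
Unset Printing Implicit Defensive.

Inductive color := Red | Blue.

(* Edges of the complete k-uniform hypergraph on the vertex set V. *)
Definition Kedges (V : finType) (k : nat) : {set {set V}} :=
  [set e : {set V} | #|e| == k].

(* es lists the edges e_1, ..., e_l, indexed from 0; the two intersection
   conditions are symmetric, so they are stated for i < j only. *)
Definition loose_path (V : finType) (k : nat) (es : seq {set V}) : Prop :=
  [/\ 1 <= size es,
      {subset es <= Kedges V k},
      forall i, i.+1 < size es ->
        #|nth set0 es i :&: nth set0 es i.+1| = 1
    & forall i j, i.+1 < j -> j < size es ->
        #|nth set0 es i :&: nth set0 es j| = 0].

(* S is the vertex set of a loose path whose edges all have color c, or one of
   the degenerate paths: any set of fewer than k vertices, of either color.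
   The values of f outside Kedges V k are irrelevant. *)
Definition mono_loose_path (V : finType) (k : nat) (f : {set V} -> color)
    (c : color) (S : {set V}) : Prop :=
  #|S| < k \/
  exists es : seq {set V},
    [/\ loose_path k es,
        forall e, e \in es -> f e = c
      & \bigcup_(e <- es) e = S].

(* Main.v *)
(** By induction on the number of edges, all but a set W of k - 1 vertices is
    covered by a red path P and a blue path Q; take P with as many edges as
    possible, and let x be a free end of Q.  If W cannot be absorbed, every
    end of P sees W in blue, and x sees W in red.  Let P consist of a start
    vertex p and successive blocks of k - 1 vertices.  Removing the last block
    B from P, x sees B in red, since otherwise Q could absorb both B and W.  On
    the other hand, by maximality of P, Q can be extended by a blue edge through
    x, all of W but one vertex w, and one vertex b of B; the uncovered set
    becomes B - b + w, and the situation repeats with x replaced by b.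
    Walking down P this way, the red edges (x, W), (x, B), (b, B'), ... form a
    red path covering W, x and all of P except p.  It has one edge more than P;
    the uncovered set is now the last block of Q with x replaced by p,
    contradicting the choice of P (or, if Q is the vertex x, p is the blue
    path). *)

Require Import Defs.
From mathcomp Require Import all_boot.
From mathcomp Require Import zify.
From Stdlib Require Import Classical_Prop.

Set Implicit Arguments.
Unset Strict Implicit.
Unset Printing Implicit Defensive.

Ltac vertexwise := rewrite ?inE; clear; lia.

Section LoosePathPartition.

Variables (V : finType) (k : nat) (f : {set V} -> color).
Hypothesis k_ge3 : 3 <= k.

Implicit Types (P Q R S T W Y E F G D : {set V}) (x y w v : V).

(** * Loose paths grown edge by edge *)

(* [grown c l S E]: S is the vertex set of a loose path with l edges of color
   c, and E is the set of vertices at which its last edge may be left. *)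
Inductive grown (c : color) : nat -> {set V} -> {set V} -> Prop :=
| GrownVertex x : grown c 0 [set x] [set x]
| GrownEdge l S E x Y : grown c l S E -> x \in E -> [disjoint S & Y] ->
    #|Y| = k.-1 -> f (x |: Y) = c -> grown c l.+1 (S :|: Y) Y.

Lemma grown_sub c l S E : grown c l S E -> E \subset S.
Proof. by case=> *; rewrite ?subsetUr. Qed.

Lemma grown_card c l S E : grown c l S E -> #|S| = (l * k.-1).+1.
Proof.
elim=> [x|{}l {}S {}E x Y _ IH _ dSY cY _]; first by rewrite cards1.
by rewrite cardsU disjoint_setI0 // cards0 subn0 IH cY mulSn; lia.
Qed.

Lemma grown_end c l S E : grown c l S E -> exists x, x \in E.
Proof.
case=> [x|{}l {}S {}E x Y _ _ _ cY _]; first by exists x; rewrite set11.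
by apply/card_gt0P; lia.
Qed.

(** The last two clauses are the induction invariant: the next edge meets [S] in one vertex of [E],
    so it meets the last edge there and misses all earlier ones. *)
Lemma grown_loose_path c l S E : grown c l S E ->
  #|S| = 1 \/
  exists es, [/\ loose_path k es, forall e, e \in es -> f e = c,
    \bigcup_(e <- es) e = S, E \subset last set0 es
    & forall i, i.+1 < size es -> [disjoint nth set0 es i & E]].
Proof.
elim=> [x|{}l {}S {}E x Y gS IH xE dSY cY fY]; first by left; rewrite cards1.
have xS : x \in S := subsetP (grown_sub gS) x xE.
have ce : #|x |: Y| = k.
  by rewrite cardsU1 (disjointFr dSY xS) cY; lia.
right; case: IH => [S1|[es [[es0 esk es1 es2] esc esS Elast Edisj]]].
  exists [:: x |: Y]; split => //.
  - split => //; first by move=> e; rewrite !inE => /eqP ->; rewrite ce.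
    by move=> i j /= ij j1; lia.
  - by move=> e; rewrite inE => /eqP ->.
  - rewrite big_seq1; move/eqP/cards1P: S1 xS => [z ->].
    by rewrite inE => /eqP ->.
  - exact: subsetUr.
have subS e : e \in es -> e \subset S.
  by move=> ees; rewrite -esS (big_rem e ees) subsetUl.
have nthS i : i < size es -> nth set0 es i \subset S.
  by move=> ?; apply/subS/mem_nth.
have dY i : i < size es -> [disjoint nth set0 es i & Y].
  by move=> /nthS sub; apply: disjointWl dSY.
exists (rcons es (x |: Y)); split.
- split; first by rewrite size_rcons.
  + by move=> e; rewrite mem_rcons inE => /orP [/eqP->|/esk//]; rewrite inE ce.
  + move=> i; rewrite size_rcons ltnS !nth_rcons => ilt; rewrite ilt.
    case: ltnP => [/es1//|ige].
    have -> : i.+1 == size es by lia.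
    have -> : nth set0 es i :&: (x |: Y) = [set x].
      rewrite setIUr (disjoint_setI0 (dY _ ilt)) setU0; apply/setIidPr.
      rewrite sub1set; have -> : i = (size es).-1 by lia.
      by rewrite nth_last (subsetP Elast).
    by rewrite cards1.
  + move=> i j ij; rewrite size_rcons ltnS !nth_rcons => jle.
    have ilt : i < size es by lia.
    rewrite ilt; case: ltnP => [|jge]; first exact: es2.
    have -> : j == size es by lia.
    rewrite setIUr (disjoint_setI0 (dY _ ilt)) setU0.
    have /disjointFl/(_ xE) xn : [disjoint nth set0 es i & E].
      by apply: Edisj; lia.
    by apply/eqP; rewrite cards_eq0 setI_eq0 disjoint_sym disjoints1 xn.
- by move=> e; rewrite mem_rcons inE => /orP [/eqP->|/esc].
- rewrite -cats1 big_cat /= big_seq1 esS setUCA setUA.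
  by congr (_ :|: Y); apply/setUidPr; rewrite sub1set.
- by rewrite last_rcons subsetUr.
- by move=> i; rewrite size_rcons ltnS nth_rcons => ilt; rewrite ilt dY.
Qed.

Lemma grown_mono c l S E : grown c l S E -> mono_loose_path k f c S.
Proof.
move/grown_loose_path => [S1|[es [? ? ? _ _]]]; first by left; lia.
by right; exists es.
Qed.

(** * Covers and near covers by two paths *)

(* Disjointness and covering are stated by counting memberships, so that they
   can be checked one vertex at a time. *)
Definition covered D := exists a b P Q E F,
  [/\ grown Red a P E, grown Blue b Q F
    & forall v, (v \in P) + (v \in Q) = (v \in D)].

(** The number [a] of red edges is a parameter because it is to be maximised. *)
Definition nearly_covered a D := exists b P Q W E F,
  [/\ grown Red a P E, grown Blue b Q F, #|W| = k.-1
    & forall v, (v \in P) + (v \in Q) + (v \in W) = (v \in D)].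

Lemma grow c l S E x Y T : grown c l S E -> x \in E -> #|Y| = k.-1 ->
  f (x |: Y) = c -> (forall v, (v \in S) + (v \in Y) = (v \in T)) ->
  grown c l.+1 T Y.
Proof.
move=> gS xE cY fY STY.
have -> : T = S :|: Y by apply/setP=> v; have := STY v; rewrite inE; lia.
apply: GrownEdge gS xE _ cY fY; apply/pred0P=> v /=.
by have := STY v; lia.
Qed.

Lemma card_swap W x y : x \in W -> y \notin W -> #|y |: (W :\ x)| = #|W|.
Proof.
move=> xW yW; rewrite cardsU1 !inE negb_and yW orbT (cardsD1 x W) xW; lia.
Qed.

Lemma eq_leq_mem v x S : x \in S -> (v == x) <= (v \in S).
Proof. by case: eqP => // -> ->. Qed.

Lemma eq_disjoint v x y : x != y -> (v == x) + (v == y) <= 1.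
Proof. by case: (eqVneq v x) => [-> /negPf->|_ _] //; case: eqP. Qed.

(** Used when [R] and [Q] share [x] and [u] is left over. If [Q] is the vertex [x], then [u] serves
    as the blue path; otherwise the last edge of [Q] is undone, and its block with [x] replaced by
    [u] is uncovered. *)
Lemma covered_swap D a R G b Q F x u :
  grown Red a R G -> grown Blue b Q F -> x \in F -> u \notin Q ->
  (forall v, (v \in R) + (v \in Q) + (v == u) = (v \in D) + (v == x)) ->
  covered D \/ nearly_covered a D.
Proof.
move=> gR gQ; case: gQ => [z|{}b S E z Y gS zE dSY cY fY].
  rewrite inE => /eqP -> _ dec; left.
  exists a, 0, R, [set u], G, [set u]; split=> // [|v]; first exact: GrownVertex.
  by have := dec v; vertexwise.
rewrite inE negb_or => xY /andP[uS uY] dec; right.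
exists b, R, S, (u |: (Y :\ x)), G, E; split=> //; first by rewrite card_swap.
move=> v; have := dec v; have := eq_leq_mem v xY.
have : (v \in S) + (v \in Y) <= 1.
  by case vS: (v \in S) => //; [rewrite (disjointFr dSY vS) | case: (v \in Y)].
have : (v == u) + (v \in Y) <= 1.
  by case: eqP => [->|_]; [rewrite (negPf uY) | case: (v \in Y)].
by vertexwise.
Qed.

(** * Lengthening the red path *)

(* Walking back along the red path P, the blue path Q eats the last block B of
   P while the red path R, which overlaps Q, is extended by the same block. *)
Lemma reroute D i P E : ~ covered D -> grown Red i P E ->
  forall b Q F W x w j R G,
  grown Blue b Q F -> x \in F -> w \in W -> #|W| = k.-1 ->
  (forall v, (v \in P) + (v \in Q) + (v \in W) = (v \in D)) ->
  (forall y, y \in E -> f (x |: (y |: (W :\ w))) = Blue) ->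
  grown Red j R G -> x \in G -> (forall v, (v \in R) + (v \in P) <= 1) ->
  exists p R' G', [/\ p \in P, grown Red (i + j) R' G'
    & forall v, (v \in R') + (v == p) = (v \in R) + (v \in P)].
Proof.
move=> nc; elim=> [p|{}i S {}E z B gS IH zE dSB cB fB] b Q F W x w j R G
  gQ xF wW cW dec blueE gR xG dRP.
  by exists p, R, G; split=> [||v]; rewrite ?inE.
have decB v : (v \in S) + (v \in B) + (v \in Q) + (v \in W) = (v \in D).
  have := dec v; rewrite inE; case vS: (v \in S) => //=.
  by rewrite (disjointFr dSB vS).
have gP : grown Red i.+1 (S :|: B) B := GrownEdge gS zE dSB cB fB.
have blueBW y : y \in B -> f (y |: W) = Blue.
  move=> yB; case fy: (f _) => //; case: nc.
  exists i.+2, b, (S :|: B :|: W), Q, W, F; split=> //.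
    by apply: grow gP yB cW fy _ => v; have := decB v; vertexwise.
  by move=> v; have := decB v; vertexwise.
(* This needs [k >= 3]: [b1] goes to the blue path, and [b2] takes over the role of [w] in the next
   round. *)
have /card_gt1P[b1 [b2 [b1B b2B b12]]] : 1 < #|B| by lia.
have redxB : f (x |: B) = Red.
  case fx: (f _) => //; case: nc.
  exists i, b.+2, S, (Q :|: B :|: W), E, W; split=> //.
    have gQB : grown Blue b.+1 (Q :|: B) B.
      by apply: grow gQ xF cB fx _ => v; have := decB v; vertexwise.
    apply: grow gQB b1B cW (blueBW _ b1B) _ => v.
    by have := decB v; vertexwise.
  by move=> v; have := decB v; vertexwise.
have b1W : b1 \notin W by have := decB b1; rewrite b1B; clear; lia.
have b2W : b2 \notin W by have := decB b2; rewrite b2B; clear; lia.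
have wB : w \notin B by have := decB w; rewrite wW; clear; lia.
have facts v : [/\ (v == b1) <= (v \in B), (v == b2) <= (v \in B),
    (v == w) <= (v \in W) & (v == b1) + (v == b2) <= 1].
  by split; [exact: eq_leq_mem..|exact: eq_disjoint].
have grow_blue y : y \in B -> y \notin W ->
    grown Blue b.+1 (Q :|: (y |: (W :\ w))) (y |: (W :\ w)).
  move=> yB yW; apply: grow gQ xF _ (blueE _ yB) _; first by rewrite card_swap.
  move=> v; move: (facts v) => [_ _]; have := eq_leq_mem v yB.
  by have := decB v; vertexwise.
have [|||v|y yE|||v|p [R' [G' [pS gR' decR']]]] := IH b.+1
    (Q :|: (b1 |: (W :\ w))) (b1 |: (W :\ w)) (w |: (B :\ b1)) b1 b2
    j.+1 (R :|: B) B (grow_blue _ b1B b1W).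
- by rewrite !inE eqxx.
- by rewrite !inE b2B (eq_sym b2 b1) b12 orbT.
- by rewrite card_swap.
- move: (facts v) (decB v) => []; vertexwise.
- have swapE : b1 |: (y |: ((w |: (B :\ b1)) :\ b2)) = y |: (w |: (B :\ b2)).
    by apply/setP=> v; move: (facts v) (decB v) => []; vertexwise.
  (* Were this edge red, [S] could absorb [w] and [B] minus [b2], and [Q] could absorb [b2] and [W]
     minus [w], covering [D]. *)
  rewrite swapE; case fy: (f _) => //; case: nc.
  exists i.+1, b.+1, (S :|: (w |: (B :\ b2))), (Q :|: (b2 |: (W :\ w))),
    (w |: (B :\ b2)), (b2 |: (W :\ w)); split; last 1 first.
  + by move=> v; move: (facts v) (decB v) => []; vertexwise.
  + apply: grow gS yE _ fy _ => [|v]; first by rewrite card_swap.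
    move: (facts v) (decB v) => []; vertexwise.
  + exact: grow_blue.
- apply: grow gR xG cB redxB _ => v.
  by have := dRP v; vertexwise.
- exact: b1B.
- by have := dRP v; have := decB v; vertexwise.
exists p, R', G'; split; first by rewrite inE pS.
  by rewrite addSnnS.
move=> v; rewrite decR'; have := decB v; have := dRP v; vertexwise.
Qed.

(** Maximality of [P] enters as the assumption [na], which makes the edges required by [reroute]
    blue; [reroute] then yields a red path with [a + 1] edges all the same. *)
Lemma lengthen_red D a : ~ covered D -> nearly_covered a D ->
  ~ ~ nearly_covered a.+1 D.
Proof.
move=> nc [b [P [Q [W [E [F [gP gQ cW dec]]]]]]] na.
have nswap R G x u : grown Red a.+1 R G -> x \in F -> u \notin Q ->
    ~ (forall v, (v \in R) + (v \in Q) + (v == u) = (v \in D) + (v == x)).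
  by move=> gR xF uQ decR; case: (covered_swap gR gQ xF uQ decR).
have [x xF] := grown_end gQ.
have xQ : x \in Q := subsetP (grown_sub gQ) x xF.
have /card_gt0P[w wW] : 0 < #|W| by lia.
have wQ : w \notin Q by have := dec w; rewrite wW; clear; lia.
have xW : x \notin W by have := dec x; rewrite xQ; clear; lia.
have facts v : [/\ (v == x) <= (v \in Q) & (v == w) <= (v \in W)].
  by split; exact: eq_leq_mem.
have redxW : f (x |: W) = Red.
  case fx: (f _) => //; case: nc.
  exists a, b.+1, P, (Q :|: W), E, W; split=> //.
    by apply: grow gQ xF cW fx _ => v; have := dec v; vertexwise.
  by move=> v; have := dec v; vertexwise.
(* The edge is grown from [w], so that it can be left at [x]. *)
have gR : grown Red 1 (x |: W) (x |: (W :\ w)).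
  apply: grow (GrownVertex Red w) (set11 w) _ _ _; first by rewrite card_swap.
    rewrite -redxW; congr f; apply/setP=> v; have [] := facts v.
    by vertexwise.
  by move=> v; move: (facts v) (dec v) => []; vertexwise.
have [y yE|v|p [R [G [pP]]]] :=
    reroute nc gP gQ xF wW cW dec _ gR (setU11 _ _).
- have yP : y \in P := subsetP (grown_sub gP) y yE.
  case fy: (f _) => //; exfalso.
  have swapE : x |: (y |: (W :\ w)) = y |: (x |: (W :\ w)) by rewrite setUCA.
  apply: (nswap (P :|: (x |: (W :\ w))) (x |: (W :\ w)) x w) => //.
    apply: grow gP yE _ _ _; [by rewrite card_swap|by rewrite -swapE|move=> v].
    by move: (facts v) (dec v) => []; vertexwise.
  by move=> v; move: (facts v) (dec v) => []; vertexwise.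
- by move: (facts v) (dec v) => []; vertexwise.
(* [R] shares [x] with [Q] and misses only [p], as [covered_swap] requires. *)
rewrite addn1 => gR' decR; apply: (nswap R G x p) => //.
  by have := dec p; rewrite pP; clear; lia.
move=> v; have [] := facts v; have := eq_leq_mem v pP.
by have := decR v; have := dec v; vertexwise.
Qed.

(** Otherwise [lengthen_red] could be iterated forever, but a red path with [a] edges has more than
    [a] vertices, all in [D]. *)
Lemma nearly_covered_covered D a : nearly_covered a D -> covered D.
Proof.
move=> na; apply: NNPP => nc.
have bound a' : nearly_covered a' D -> a' < #|D|.
  move=> [b [P [Q [W [E [F [gP gQ cW dec]]]]]]].
  have : #|P| <= #|D|.
    apply/subset_leq_card/subsetP=> v vP.
    by have := dec v; rewrite vP; clear; lia.
  by rewrite (grown_card gP); nia.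
suff none d a' : #|D| - a' <= d -> ~ nearly_covered a' D.
  exact: (none _ _ (leqnn _) na).
elim: d a' => [|d IH] a' le na'; first by have := bound _ na'; lia.
apply: (lengthen_red nc na'); apply: IH; lia.
Qed.

(** Setting aside [k - 1] vertices and covering the rest by induction gives a near cover. *)
Lemma covered_of_card m D : #|D| = m * k.-1 + 2 -> covered D.
Proof.
elim: m D => [|m IH] D cD.
  have /eqP/cards2P[x [y [xy ->]]] : #|D| = 2 by [].
  exists 0, 0, [set x], [set y], [set x], [set y].
  split; [exact: GrownVertex..|move=> v].
  by have := eq_disjoint v xy; vertexwise.
rewrite mulSn in cD.
have [W sWD cW] : exists2 W : {set V}, W \subset D & #|W| = k.-1.
  have /card_geqP[s [us ss sD]] : k.-1 <= #|D| by rewrite cD -addnA leq_addr.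
  exists [set x in s]; first by apply/subsetP=> x; rewrite inE => /sD.
  by rewrite cardsE (card_uniqP us).
have [|a [b [P [Q [E [F [gP gQ dec]]]]]]] := IH (D :\: W).
  by rewrite cardsD (setIidPr sWD) cD cW -addnA addKn.
apply: (@nearly_covered_covered D a).
exists b, P, Q, W, E, F; split=> // v; have := dec v; rewrite !inE.
by have := subsetP sWD v; lia.
Qed.

End LoosePathPartition.

Theorem theorem2p1 (k n : nat) (V : finType) (f : {set V} -> color)
    (hk : 3 <= k) (hn : 0 < n) (hmod : n = 2 %[mod k - 1]) (hV : #|V| = n) :
  exists R B : {set V},
    [/\ mono_loose_path k f Red R,
        mono_loose_path k f Blue B,
        R :&: B = set0
      & R :|: B = [set: V]].
Proof.
have [m nE] : exists m, n = m * k.-1 + 2.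
  have n2 : 2 <= n.
    case: n hn hmod {hV} => [|[|n]] // _ hmod.
    (* The case [n = 1] is impossible: 2 modulo [k - 1] is 0 if [k = 3] and 2 otherwise. *)
    have : 1 = (k - 1 != 2) * 2.
      rewrite -[LHS](@modn_small 1 (k - 1)); last by lia.
      rewrite hmod; case: eqP => [->|?] //=; rewrite modn_small; lia.
    by case: eqP.
  move/eqP: hmod; rewrite eqn_mod_dvd // => /dvdnP[m mE].
  by exists m; lia.
have [|a [b [P [Q [E [F [gP gQ dec]]]]]]] := @covered_of_card V k f hk m setT.
  by rewrite cardsT hV.
exists P, Q; split; [exact: grown_mono gP|exact: grown_mono gQ|..].
all: by apply/setP=> v; have := dec v; vertexwise.
Qed.
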